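(* Let $k\ge 2$ and $n\ge 1$ be integers, and let $X\subseteq[0,1]^n$ be a topologically closed $k$-automatic set recognized by a closed Büchi automaton $\mathcal{A}$ with alphabet $\{0,\dots,k-1\}^n$. Then $$d_H(X)=d_B(X)=\frac{1}{\log k}\,h(L(\mathcal{A})),$$ where $L(\mathcal{A})$ is the set of (finite) strings that $\mathcal{A}$ recognizes.
   Context: A Büchi automaton is a 5-tuple $\mathcal{A}=(Q,\Sigma,\delta,S,F)$ with $Q$ a finite set of states, $\Sigma$ a finite alphabet, $\delta:Q\times\Sigma\to\mathcal{P}(Q)$ the transition function, $S\subseteq Q$ nonempty (start states), $F\subseteq Q$ (accept states). A run of $w=w_1w_2\cdots\in\Sigma^\omega$ is a sequence $q_0,q_1,\dots$ of states with $q_0\in S$ and $q_i\in\delta(q_{i-1},w_i)$ for $i\ge1$; it is accepting if $q_i\in F$ for infinitely many $i$. $\mathcal{A}$ accepts $w$ if some run of $w$ is accepting; the $\omega$-language recognized is the set of accepted infinite strings. The same tuple can be treated as a finite automaton: a finite string $w_1\cdots w_m$ is accepted if there is a sequence $q_0,\dots,q_m$ with $q_0\in S$, $q_i\in\delta(q_{i-1},w_i)$ and $q_m\in F$; the set of accepted finite strings is the language recognized as a finite automaton. $\mathcal{A}$ carries a digraph structure with vertex set $Q$ and an edge $(q,q')$ whenever $q'\in\delta(q,\sigma)$ for some $\sigma\in\Sigma$. $\mathcal{A}$ is trim if for each $q\in Q$ there is a path (possibly of length zero) from a start state to $q$ and a path of nonzero length from $q$ to an accept state. $\mathcal{A}$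 is closed if it is trim and $Q=F$. Write $[k]=\{0,\dots,k-1\}$. For $w=w_0w_1\cdots\in[k]^\omega$, $\nu_k(w)=\sum_{i\ge0}w_i k^{-(i+1)}$; for strings over $[k]^n$, $\nu_k$ is applied coordinatewise, giving a map $([k]^n)^\omega\to[0,1]^n$. A set $X\subseteq[0,1]^n$ is $k$-automatic, and $\mathcal{A}$ recognizes $X$, if $\mathcal{A}$ is a Büchi automaton with alphabet $[k]^n$ recognizing the maximal $\omega$-language $L$ with $\nu_k(L)=X$ (i.e. the set of all base-$k$ representations of elements of $X$). For an infinite language $L\subseteq\Sigma^*$, $|L|_m$ is the number of strings of length $m$ in $L$ and the entropy is $h(L)=\limsup_{m\to\infty}\frac{\log|L|_m}{m}$. $d_H$ is Hausdorff dimension and $d_B$ is box-counting (Minkowski) dimension; the equality includes the assertion that $d_B(X)$ exists. *)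

(* Defs.v *)
(* MathComp / MathComp-Analysis; R^n is 'rV[R]_n over an arbitrary realType R. *)
From mathcomp Require Import all_boot all_order all_algebra.
From mathcomp Require Import all_classical all_reals all_analysis.

Set Implicit Arguments.
Unset Strict Implicit.
Unset Printing Implicit Defensive.

Import Order.TTheory GRing.Theory Num.Theory.
Import numFieldNormedType.Exports.

Local Open Scope classical_set_scope.
Local Open Scope ring_scope.

Record automaton (Sigma : finType) := Automaton {
  state : finType;
  trans : state -> Sigma -> {set state};
  start : {set state};
  accept : {set state};
  start_neq0 : start != finset.set0
}.

(* Infinite strings are functions nat -> Sigma indexed from 0, so the (i+1)-st
   state is reached by reading letter number i. *)
Definition is_run (Sigma : finType) (A : automaton Sigma) (w : nat -> Sigma)
    (q : nat -> state A) : Prop :=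
  q 0%N \in start A /\ forall i, q i.+1 \in trans (q i) (w i).

Definition accepting_run (Sigma : finType) (A : automaton Sigma)
    (w : nat -> Sigma) (q : nat -> state A) : Prop :=
  is_run w q /\ infinite_set [set i | q i \in accept A].

Definition omega_language (Sigma : finType) (A : automaton Sigma) :
    set (nat -> Sigma) :=
  [set w | exists q : nat -> state A, accepting_run w q].

(* The sequence q_0, ..., q_m is a function on 'I_m.+1; inord injects the
   indices i and i.+1, both at most m, into that type. *)
Definition finite_language (Sigma : finType) (A : automaton Sigma) :
    set (seq Sigma) :=
  [set w | exists q : 'I_(size w).+1 -> state A,
    [/\ q ord0 \in start A,
        forall i : 'I_(size w),
          q (inord i.+1) \in trans (q (inord i)) (tnth (in_tuple w) i)
      & q ord_max \in accept A]].

Definition edge (Sigma : finType) (A : automaton Sigma) : rel (state A) :=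
  [rel q q' | [exists sigma, q' \in trans q sigma]].

Definition trim (Sigma : finType) (A : automaton Sigma) : Prop :=
  forall q : state A,
    (exists s p, [/\ s \in start A, path (@edge _ A) s p & last s p = q]) /\
    (exists p, [/\ p != [::], path (@edge _ A) q p & last q p \in accept A]).

Definition closed_automaton (Sigma : finType) (A : automaton Sigma) : Prop :=
  trim A /\ accept A = [set: state A]%SET.

(* The alphabet [k]^n. *)
Notation letter k n := {ffun 'I_n -> 'I_k}.

Definition digit_value (R : realType) (k : nat) (w : nat -> 'I_k) : R :=
  limn (series (fun i => (w i)%:R / k%:R ^+ i.+1 : R)).

Definition nu (R : realType) (k n : nat) (w : nat -> letter k n) : 'rV[R]_n :=
  \row_j digit_value R (fun i => w i j).

Definition unit_cube (R : realType) (n : nat) : set 'rV[R]_n :=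
  [set x | forall j, 0 <= x ord0 j <= 1].

Definition recognizes (R : realType) (k n : nat) (A : automaton (letter k n))
    (X : set 'rV[R]_n) : Prop :=
  @nu R k n @` omega_language A = X /\
  forall L : set (nat -> letter k n),
    @nu R k n @` L = X -> L `<=` omega_language A.

Definition automatic (R : realType) (k n : nat) (X : set 'rV[R]_n) : Prop :=
  X `<=` @unit_cube R n /\ exists A : automaton (letter k n), recognizes A X.

Definition num_strings (Sigma : finType) (L : set (seq Sigma)) (m : nat) : nat :=
  #|[set t : m.-tuple Sigma | `[< L t >]]%SET|.

(* lne 0 = -oo, so lengths at which L has no string do not affect the limsup
   for infinite L. *)
Definition entropy (R : realType) (Sigma : finType) (L : set (seq Sigma)) :
    \bar R :=
  limn_esup (fun m : nat =>
    (lne ((num_strings L m)%:R%:E) * (m%:R^-1)%:E)%E).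

Definition euclidean_dist (R : realType) (n : nat) (x y : 'rV[R]_n) : R :=
  Num.sqrt (\sum_(j < n) (x ord0 j - y ord0 j) ^+ 2).

(* -oo on the empty set; diam_pow below treats that case separately. *)
Definition diam (R : realType) (n : nat) (U : set 'rV[R]_n) : \bar R :=
  ereal_sup [set d | exists x y,
    [/\ U x, U y & d = (euclidean_dist x y)%:E]].

(* Convention for s = 0: the empty set has weight 0, a nonempty set weight 1,
   which makes the 0-dimensional measure the counting measure. *)
Definition diam_pow (R : realType) (n : nat) (s : R) (U : set 'rV[R]_n) :
    \bar R :=
  if U == set0 then 0%E else poweR (diam U) s.

Definition hausdorff_content (R : realType) (n : nat) (s delta : R)
    (X : set 'rV[R]_n) : \bar R :=
  ereal_inf [set (\sum_(0 <= i <oo) diam_pow s (U i))%E |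
    U in [set U : nat -> set 'rV[R]_n |
      X `<=` \bigcup_i U i /\ forall i, (diam (U i) <= delta%:E)%E]].

(* The content is nonincreasing in delta, so this supremum is its limit as
   delta tends to 0. *)
Definition hausdorff_measure (R : realType) (n : nat) (s : R)
    (X : set 'rV[R]_n) : \bar R :=
  ereal_sup [set hausdorff_content s delta X | delta in [set d : R | 0 < d]].

Definition hausdorff_dim (R : realType) (n : nat) (X : set 'rV[R]_n) : \bar R :=
  ereal_inf [set s%:E | s in
    [set s : R | 0 <= s /\ hausdorff_measure s X = 0%E]].

Definition box (R : realType) (n : nat) (eps : R) (c : 'rV[R]_n) :
    set 'rV[R]_n :=
  [set x | forall j, c ord0 j <= x ord0 j <= c ord0 j + eps].

(* Least number of boxes of side eps covering X; +oo if there is no finite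
   cover. *)
Definition box_count (R : realType) (n : nat) (eps : R) (X : set 'rV[R]_n) :
    \bar R :=
  ereal_inf [set m%:R%:E | m in
    [set m : nat | exists c : 'I_m -> 'rV[R]_n,
      X `<=` \bigcup_i box eps (c i)]].

Definition box_ratio (R : realType) (n : nat) (X : set 'rV[R]_n) (eps : R) :
    \bar R :=
  (lne (box_count eps X) * ((ln eps^-1)^-1)%:E)%E.

Definition box_dim_exists (R : realType) (n : nat) (X : set 'rV[R]_n) : Prop :=
  cvg (box_ratio X eps @[eps --> 0^'+]).

(* Meaningful only when box_dim_exists X. *)
Definition box_dim (R : realType) (n : nat) (X : set 'rV[R]_n) : \bar R :=
  lim (box_ratio X eps @[eps --> 0^'+]).

(* Main.v *)
Require Import Defs.
From mathcomp Require Import all_boot all_order all_algebra.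
From mathcomp Require Import all_classical all_reals all_analysis.
From mathcomp Require Import ring lra zify.
Import Order.TTheory GRing.Theory Num.Theory.
Import numFieldNormedType.Exports.
Local Open Scope classical_set_scope.
Local Open Scope ring_scope.

Set Implicit Arguments.
Unset Strict Implicit.
Unset Printing Implicit Defensive.

(** The set X is the image under nu of the infinite words readable from a start
    state: all states accept, so acceptance is automatic.  Its level-m cubes of
    side k^-m are indexed by the words of length m in the finite language L,
    because each such word extends to an infinite one.  Write |L|_m for their
    number.

    Up to the factor 5^n, |L|_m is the number of boxes of side k^-m needed to
    cover X, since a box of that side meets at most 5^n cubes of that level
    (num_cubes_met).  So the box dimension is governed by (log |L|_m) / m, and
    what remains is to show that this sequence converges to h log k, where h is
    the Hausdorff dimension.  Two estimates give this.

    Lower bound on |L|_m: if |L|_m <= k^(s m) for infinitely many m, the covers by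
    level-m cubes show that the s'-dimensional measure of X vanishes for every
    s' > s (growth_hausdorff_null).

    Upper bound on |L|_m: if the s-dimensional measure of X vanishes, then it is
    at most a constant times k^(s m) (hausdorff_null_growth).  This is Furstenberg's
    argument for closed sets invariant under multiplication by k.  Every state
    q can be reached from a start state, so X contains a scaled copy of the set
    coded by the words readable from q; hence an efficient cover of X gives
    families of words W_i, of lengths l_i >= 1 and total weight
    \sum_i |W_i| k^(- s l_i) <= 1, such that every infinite word readable from
    any state starts with a word of some W_i.  By compactness finitely many of
    them suffice (cylinder_cover_compact), and splitting off the first factor of
    a readable word bounds the number a_m of readable words of length m by
    \sum_i |W_i| a_(m - l_i), so that a_m k^(- s m) stays bounded
    (factors_growth).  The set coded by all states together is invariant under
    the shift while X need not be, which is why a_m counts words readable from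
    an arbitrary state. *)

(** * Words read by an automaton *)

Lemma mkseq_recl (T : Type) (w : nat -> T) (m : nat) :
  mkseq w m.+1 = w 0%N :: mkseq (fun i => w i.+1) m.
Proof. by rewrite /mkseq /= -(addn0 1%N) iotaDl -map_comp. Qed.

Fixpoint prepend (T : Type) (s : seq T) (w : nat -> T) : nat -> T :=
  if s is a :: t then fun i => if i is j.+1 then prepend t w j else a else w.

Lemma mkseq_prepend (T : Type) (s : seq T) (w : nat -> T) (m : nat) :
  mkseq (prepend s w) (size s + m) = s ++ mkseq w m.
Proof. by elim: s => //= a s IH; rewrite addSn mkseq_recl /= -IH. Qed.

Section Reading.
Variables (Sigma : finType) (A : automaton Sigma).
Implicit Types (q : state A) (s t : seq Sigma) (w : nat -> Sigma).

Fixpoint readable q s : bool :=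
  if s is a :: t then [exists q', (q' \in trans q a) && readable q' t]
  else true.

Definition inf_readable q : set (nat -> Sigma) :=
  [set w | exists r : nat -> state A,
     r 0%N = q /\ forall i, r i.+1 \in trans (r i) (w i)].

Lemma inf_readable_tail q w : inf_readable q w ->
  exists2 q', q' \in trans q (w 0%N) & inf_readable q' (fun i => w i.+1).
Proof.
move=> [r [r0 rS]]; exists (r 1%N); first by rewrite -r0.
by exists (fun i => r i.+1); split => // i; exact: rS.
Qed.

Lemma inf_readable_prepend1 q q' a w : q' \in trans q a ->
  inf_readable q' w -> inf_readable q (prepend [:: a] w).
Proof.
move=> qa [r [r0 rS]]; exists (fun i => if i is j.+1 then r j else q).
by split => // -[|i] /=; [rewrite r0 | exact: rS].
Qed.

Lemma readable_prefix q w m : inf_readable q w -> readable q (mkseq w m).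
Proof.
elim: m q w => // m IH q w /inf_readable_tail[q' qq' wq'].
by rewrite mkseq_recl /=; apply/existsP; exists q'; rewrite qq' IH.
Qed.

Lemma readable_take q s m : readable q s -> readable q (take m s).
Proof.
elim: s q m => [|a s IH] q [|m] //= /existsP[q' /andP[qq' sq']].
by apply/existsP; exists q'; rewrite qq' IH.
Qed.

Lemma readable_drop q s m : readable q s -> exists q', readable q' (drop m s).
Proof.
elim: s q m => [|a s IH] q [|m] //=; try by exists q.
by move=> /existsP[q' /andP[_ /IH]]; apply.
Qed.

Lemma finite_languageE s : accept A = [set: state A]%SET ->
  finite_language A s <-> exists2 q, q \in start A & readable q s.
Proof.
move=> accT; split.
- move=> [r [r0 rS _]]; exists (r ord0) => //.
  have {}rS i : (i < size s)%N ->
      forall a, r (inord i.+1) \in trans (r (inord i)) (nth a s i).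
    by move=> ls a; have := rS (Ordinal ls); rewrite (tnth_nth a).
  have -> : ord0 = inord 0 :> 'I_(size s).+1.
    by apply/val_inj; rewrite /= inordK.
  suff main m i : (i + m = size s)%N -> readable (r (inord i)) (drop i s).
    by rewrite -[s in readable _ s]drop0; exact: main.
  elim: m i => [|m IH] i.
    by rewrite addn0 => ->; rewrite drop_size.
  move=> im; have ls : (i < size s)%N by rewrite -im addnS ltnS leq_addr.
  have [a0 _] : exists a : Sigma, true by case: (s) ls => // a; exists a.
  rewrite (drop_nth a0) //=; apply/existsP; exists (r (inord i.+1)).
  by rewrite rS // IH // addSnnS.
- move=> [q qS qs].
  suff [r [r0 rS]] : exists r : nat -> state A, r 0%N = q /\
      forall i, (i < size s)%N -> forall a, r i.+1 \in trans (r i) (nth a s i).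
    exists (fun i => r i); split; first by rewrite r0.
      move=> i; rewrite (tnth_nth (tnth (in_tuple s) i)) !inordK ?ltnS//.
        exact: rS.
      by rewrite ltnW.
    by rewrite accT finset.inE.
  elim: s q {qS} qs => [|a s IH] q /=; first by exists (fun=> q).
  move=> /existsP[q' /andP[qq' /IH[r [r0 rS]]]].
  exists (fun i => if i is j.+1 then r j else q); split => // -[|i] /=.
    by rewrite r0.
  exact: rS.
Qed.

Lemma trim_live : trim A -> forall q, exists a q', q' \in trans q a.
Proof.
move=> tA q; have [_ [p [+ + _]]] := tA q.
case: p => //= q' p _ /andP[/existsP[a qa] _].
by exists a, q'.
Qed.

Lemma inf_readable_exists q :
  (forall q, exists a q', q' \in trans q a) -> exists w, inf_readable q w.
Proof.
move=> live.
have /choice[f fP] : forall q, exists aq : Sigma * state A,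
    aq.2 \in trans q aq.1.
  by move=> {}q; have [a [q' qa]] := live q; exists (a, q').
pose r i := iter i (fun q => (f q).2) q.
by exists (fun i => (f (r i)).1), r; split => // i; exact: fP.
Qed.

Lemma readable_extends q s : (forall q, exists a q', q' \in trans q a) ->
  readable q s -> exists2 w, inf_readable q w & mkseq w (size s) = s.
Proof.
move=> live; elim: s q => [|a s IH] q /=.
  by move=> _; have [w qw] := inf_readable_exists q live; exists w.
move=> /existsP[q' /andP[qq' /IH[w q'w ws]]].
exists (prepend [:: a] w); first exact: inf_readable_prepend1 q'w.
by rewrite mkseq_recl /= -[in RHS]ws.
Qed.

Lemma closed_omega_language w : accept A = [set: state A]%SET ->
  omega_language A w <-> exists2 q, q \in start A & inf_readable q w.
Proof.
move=> accT; split.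
  by move=> [r [[r0 rS] _]]; exists (r 0%N) => //; exists r.
move=> [q qS [r [r0 rS]]]; exists r; split; first by split; rewrite ?r0.
rewrite (_ : [set i | _] = setT); first exact: infinite_nat.
by apply/seteqP; split=> i //= _; rewrite accT finset.inE.
Qed.

(** By self-similarity of nu, the word u q maps the set coded by the words
    readable from q onto a scaled copy of itself inside X; this is how covers of
    X control all states at once. *)
Lemma closed_access : closed_automaton A -> exists u : state A -> seq Sigma,
  forall q w, inf_readable q w -> omega_language A (prepend (u q) w).
Proof.
move=> [tA accT].
have path_word p q0 : path (@edge _ A) q0 p -> exists u, forall w,
    inf_readable (last q0 p) w -> inf_readable q0 (prepend u w).
  elim: p q0 => [|q p IH] q0 /=; first by exists [::].
  move=> /andP[/existsP[a q0q] /IH[u uP]]; exists (a :: u) => w /uP.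
  exact: inf_readable_prepend1.
suff /choice[u uP] : forall q, exists u, forall w, inf_readable q w ->
    omega_language A (prepend u w) by exists u.
move=> q.
have [[q0 [p [q0S /path_word[u uP] <-]]] _] := tA q.
by exists u => w /uP q0w; apply/closed_omega_language => //; exists q0.
Qed.

(** Compactness of the space of infinite runs, in the form of Koenig's lemma:
    the finite runs avoiding all the families form a finitely branching tree
    without infinite branch.  A single M bounds the length to look at and the
    indices of the families in use. *)
Lemma cylinder_cover_compact (l : nat -> nat) (W : nat -> set (seq Sigma)) :
  (forall q w, inf_readable q w -> exists i, W i (mkseq w (l i))) ->
  exists M, forall q t, readable q t -> size t = M ->
    exists2 i, (i < M)%N & (l i <= M)%N /\ W i (take (l i) t).
Proof.
move=> cover.
(* good (s, q) M: once s has been read and q reached, M further letters always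
   complete a caught word.  If no M is good for (s, q), some successor has the
   same defect, and following such successors gives a word that is never
   caught. *)
pose hits s t M := exists2 i, (i < M)%N &
  (l i <= size (s ++ t))%N /\ W i (take (l i) (s ++ t)).
pose good (x : seq Sigma * state A) M :=
  forall t, readable x.2 t -> size t = M -> hits x.1 t M.
have good_mono x M M' : (M <= M')%N -> good x M -> good x M'.
  move=> MM' gM t xt tM'.
  have stM : size (take M t) = M by rewrite size_takel // tM'.
  have [i iM [li Wi]] := gM (take M t) (readable_take M xt) stM.
  have xtE : x.1 ++ t = (x.1 ++ take M t) ++ drop M t.
    by rewrite -catA cat_take_drop.
  exists i; first exact: leq_trans MM'.
  by rewrite xtE takel_cat // size_cat; split => //; exact: leq_trans (leq_addr _ _).
have good_step x : ~ (exists M, good x M) -> exists y : Sigma * state A,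
    y.2 \in trans x.2 y.1 /\ ~ (exists M, good (rcons x.1 y.1, y.2) M).
  apply: contra_notP => nx.
  have /choice[M MP] : forall y : Sigma * state A, exists M,
      y.2 \in trans x.2 y.1 -> good (rcons x.1 y.1, y.2) M.
    move=> y; have [xy|] := boolP (y.2 \in trans x.2 y.1); last by exists 0%N.
    apply: contrapT => ny; apply: nx; exists y; split=> // -[M gM].
    by apply: ny; exists M.
  exists (\max_y M y).+1 => -[//|a t] /= /existsP[q' /andP[xq' q't]] [tM].
  have [|i iM] := good_mono _ _ _ (leq_bigmax (a, q')) (MP (a, q') xq') t q't.
    by [].
  by rewrite -cats1 -catA /= => ?; exists i => //; exact: ltnW.
have [M MP] : exists M, forall q, good ([::], q) M.
  suff /choice[M MP] : forall q, exists M, good ([::], q) M.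
    exists (\max_q M q)%N => q; apply: good_mono (MP q); exact: leq_bigmax.
  move=> q; apply: contrapT => bad0.
  pose bad x := ~ exists M, good x M.
  have /choice[f fP] : forall x : {x | bad x}, exists y : {x | bad x}, exists2 a,
        (sval y).2 \in trans (sval x).2 a & (sval y).1 = rcons (sval x).1 a.
    move=> [x bx]; have [[a q'] [/= xq' by_]] := good_step x bx.
    by exists (exist bad _ by_), a.
  pose c i := iter i f (exist bad _ bad0).
  have /choice[w wP] : forall i, exists a,
      (sval (c i.+1)).2 \in trans (sval (c i)).2 a /\
      (sval (c i.+1)).1 = rcons (sval (c i)).1 a.
    by move=> i; have [a ? ?] := fP (c i); exists a.
  have cE i : (sval (c i)).1 = mkseq w i.
    by elim: i => // i IH; rewrite mkseqS -IH; case: (wP i).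
  have [|i Wi] := cover q w.
    by exists (fun i => (sval (c i)).2); split => // i; case: (wP i).
  case: (c (l i)) (cE (l i)) => x bx /= xE; apply: bx.
  exists i.+1 => t _ _; exists i => //.
  by rewrite xE size_cat size_mkseq leq_addr take_size_cat ?size_mkseq.
exists M => q t qt tM; have [i iM [/= li Wi]] := MP q t qt tM.
by exists i => //; rewrite -tM.
Qed.
End Reading.

(** * Counting words *)

Section Counting.
Variable Sigma : finType.
Implicit Types P Q : set (seq Sigma).

Lemma num_strings_le P Q m :
  (forall s, size s = m -> P s -> Q s) -> (num_strings P m <= num_strings Q m)%N.
Proof.
move=> PQ; apply/subset_leq_card/fintype.subsetP => t.
by rewrite !finset.inE => /asboolP Pt; apply/asboolP/PQ; rewrite ?size_tuple.
Qed.

Lemma num_strings_gt0 P s : P s -> (0 < num_strings P (size s))%N.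
Proof.
move=> Ps; apply/card_gt0P; exists (in_tuple s).
by rewrite finset.inE; exact/asboolP.
Qed.

Lemma num_strings_max P m : (num_strings P m <= #|Sigma| ^ m)%N.
Proof. by rewrite -card_tuple; exact: max_card. Qed.

Lemma num_strings_cover (I : finType) P (Q : I -> set (seq Sigma)) m :
  (forall s, size s = m -> P s -> exists i, Q i s) ->
  (num_strings P m <= \sum_i num_strings (Q i) m)%N.
Proof.
move=> PQ; apply: (@leq_trans
    #|(\bigcup_i [set t : m.-tuple Sigma | `[< Q i t >]])%SET|).
  apply/subset_leq_card/fintype.subsetP => t.
  rewrite finset.inE => /asboolP /PQ[|i Qi]; first by rewrite size_tuple.
  by apply/bigcupP; exists i => //; rewrite finset.inE; exact/asboolP.
elim/big_ind2: _ => [|A1 c1 A2 c2 H1 H2|//]; first by rewrite cards0.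
by rewrite (leq_trans _ (leq_add H1 H2)) // -cardsUI leq_addr.
Qed.

Lemma num_strings_cat P Q l m :
  (num_strings [set s | P (take l s) /\ Q (drop l s)] (l + m) <=
   num_strings P l * num_strings Q m)%N.
Proof.
rewrite /num_strings -cardsX.
pose f (u : l.-tuple Sigma * m.-tuple Sigma) := cat_tuple u.1 u.2.
apply: leq_trans (leq_imset_card f _).
apply/subset_leq_card/fintype.subsetP => t.
rewrite finset.inE => /asboolP[Pt Qt].
have st : size (take l t) == l by rewrite size_takel // size_tuple leq_addr.
have sd : size (drop l t) == m by rewrite size_drop size_tuple addKn.
apply/imsetP; exists (Tuple st, Tuple sd); last first.
  by apply/val_inj; rewrite /= cat_take_drop.
by rewrite !finset.inE /=; apply/andP; split; exact/asboolP.
Qed.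
End Counting.

Definition factors (Sigma : finType) (A : automaton Sigma) : set (seq Sigma) :=
  [set s | exists q : state A, readable q s].

(** Furstenberg's argument.  A long readable word starts with a word from one of
    the families, and what is left is readable again, so
    a_m <= \sum_i |W_i| a_(m - l_i), where a_m counts the readable words of
    length m.  Multiplied by x^m, this bounds a_m x^m by a combination of earlier
    values with weights |W_i| x^(l_i) of sum at most 1. *)
Lemma factors_growth (R : realType) (Sigma : finType) (A : automaton Sigma)
    (x : R) (l : nat -> nat) (W : nat -> set (seq Sigma)) :
  0 < x -> (forall i, (0 < l i)%N) ->
  (forall (q : state A) w, inf_readable q w -> exists i, W i (mkseq w (l i))) ->
  (forall M, \sum_(i < M) (num_strings (W i) (l i))%:R * x ^+ l i <= 1) ->
  exists2 C, 0 < C & forall m, (num_strings (factors A) m)%:R * x ^+ m <= C.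
Proof.
move=> x0 l0 /cylinder_cover_compact[M MP] W1.
pose a m := num_strings (factors A) m.
have rec m : (M <= m)%N ->
    (a m <= \sum_(i < M | l i <= m) num_strings (W i) (l i) * a (m - l i))%N.
  move=> Mm; pose Q (i : 'I_M) : set (seq Sigma) := [set s |
    (l i <= m)%N /\ (W i (take (l i) s) /\ factors A (drop (l i) s))].
  apply: (@leq_trans (\sum_(i < M) num_strings (Q i) m)).
    apply: num_strings_cover => s sm [q qs].
    have [||i iM [liM Wi]] := MP q (take M s); first exact: readable_take.
      by rewrite size_takel ?sm.
    exists (Ordinal iM); split; first exact: leq_trans Mm.
    by split; [rewrite take_takel in Wi | exact: readable_drop qs].
  rewrite [leqRHS]big_mkcond /=; apply: leq_sum => i _; case: ifPn => lim.
    rewrite -{1}(subnKC lim).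
    apply: leq_trans (num_strings_cat _ _ _ _).
    by apply: num_strings_le => s _ [].
  rewrite leqn0 cards_eq0; apply/eqP/setP => t; rewrite !finset.inE.
  by apply/asboolP => -[]; rewrite (negPf lim).
pose C := \sum_(j < M) (a j)%:R * x ^+ j + 1.
have ax_ge0 j : 0 <= (a j)%:R * x ^+ j by rewrite mulr_ge0 // exprn_ge0 // ltW.
have C0 : 0 < C by rewrite ltr_wpDl // sumr_ge0.
exists C => // m; rewrite -/(a m); elim/ltn_ind: m => m IH.
have [mM|Mm] := ltnP m M.
  rewrite /C (bigD1 (Ordinal mM)) //= -addrA lerDl addr_ge0 //.
  by rewrite sumr_ge0.
apply: (@le_trans _ _
    (\sum_(i < M) (num_strings (W i) (l i))%:R * x ^+ l i * C)); last first.
  by rewrite -mulr_suml ler_piMl ?W1 // ltW.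
apply: (@le_trans _ _ (\sum_(i < M | (l i <= m)%N)
    (num_strings (W i) (l i) * a (m - l i))%N%:R * x ^+ m)).
  by rewrite -mulr_suml -natr_sum ler_wpM2r ?exprn_ge0 ?ler_nat ?rec // ltW.
rewrite big_mkcond /=; apply: ler_sum => i _; case: ifPn => lim; last first.
  by rewrite !mulr_ge0 ?exprn_ge0 // ltW.
rewrite -[in x ^+ m](subnKC lim) exprD natrM mulrACA ler_wpM2l //.
  by rewrite mulr_ge0 ?exprn_ge0 // ltW.
by apply: IH; rewrite ltn_subrL l0 (leq_trans (l0 i)).
Qed.

(** * Base-k expansions *)

Fixpoint radix_value (k : nat) (s : seq 'I_k) : nat :=
  if s is a :: t then (a * k ^ size t + radix_value t)%N else 0%N.

Lemma radix_value_lt (k : nat) (s : seq 'I_k) :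
  (radix_value s < k ^ size s)%N.
Proof.
elim: s => [|a s IH] //=; rewrite expnS.
apply: (@leq_trans (a.+1 * k ^ size s)); last by rewrite leq_mul2r ltn_ord orbT.
by rewrite mulSnr ltn_add2l.
Qed.

Lemma radix_value_inj (k : nat) (s t : seq 'I_k) :
  size s = size t -> radix_value s = radix_value t -> s = t.
Proof.
elim: s t => [|a s IH] [|b t] //= [st]; rewrite -st => E.
have k0 : (0 < k ^ size s)%N by rewrite expn_gt0 (leq_trans _ (ltn_ord a)).
have div_eq (c : 'I_k) (r : seq 'I_k) : size r = size s ->
    ((c * k ^ size s + radix_value r) %/ k ^ size s = c)%N.
  by move=> rs; rewrite divnMDl // divn_small ?addn0 // -rs radix_value_lt.
have ab : a = b.
  by apply/val_inj; rewrite /= -(div_eq a s erefl) E div_eq.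
by rewrite ab in E *; rewrite (IH t) //; exact: addnI E.
Qed.

Section DigitValue.
Variables (R : realType) (k : nat).
Hypothesis hk : (1 < k)%N.
Implicit Types w : nat -> 'I_k.
Local Notation b := (k%:R^-1 : R).
Local Notation terms w := (fun i => (w i)%:R / k%:R ^+ i.+1 : R).

Lemma radix_gt0 : 0 < b. Proof. by rewrite invr_gt0 ltr0n ltnW. Qed.

Lemma radix_lt1 : b < 1.
Proof. by rewrite invf_lt1 ?ltr1n // ltr0n ltnW. Qed.

Lemma digit_series_le w m : series (terms w) m <= 1 - b ^+ m.
Proof.
rewrite /series /=; elim: m => [|m IH]; first by rewrite big_nil expr0 subrr.
rewrite big_nat_recr //= (le_trans (lerD IH (lexx _))) //.
rewrite -addrA lerD2l -exprVn exprS mulrA.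
have : (w m)%:R * b <= 1 - b.
  rewrite lerBrDr -[X in _ + X]mul1r -mulrDl ler_pdivrMr ?ltr0n 1?ltnW // mul1r.
  by rewrite natr1 ler_nat.
move/(ler_wpM2r (exprn_ge0 m (ltW radix_gt0))); lra.
Qed.

Lemma digit_terms_ge0 w i : 0 <= terms w i.
Proof. by rewrite divr_ge0 // exprn_ge0. Qed.

Lemma is_cvg_digit_series w : cvgn (series (terms w)).
Proof.
apply: nondecreasing_is_cvgn.
  apply/nondecreasing_seqP => m; rewrite /series /= big_nat_recr //= lerDl.
  exact: digit_terms_ge0.
by exists 1 => _ [m _ <-]; rewrite (le_trans (digit_series_le w m)).
Qed.

Lemma digit_value_ge0 w : 0 <= digit_value R w.
Proof.
apply: limr_ge; first exact: is_cvg_digit_series.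
by apply: nearW => m; rewrite /series /= sumr_ge0 // => i _; exact: digit_terms_ge0.
Qed.

Lemma digit_value_le1 w : digit_value R w <= 1.
Proof.
apply: limr_le; first exact: is_cvg_digit_series.
by apply: nearW => m; rewrite (le_trans (digit_series_le w m)).
Qed.

Lemma digit_value_recl w :
  digit_value R w = b * ((w 0%N)%:R + digit_value R (fun i => w i.+1)).
Proof.
pose w' := fun i => w i.+1.
have E m : series (terms w) m.+1 = b * ((w 0%N)%:R + series (terms w') m).
  rewrite /series /= big_nat_recl // expr1 mulrDr mulrC; congr (_ + _).
  rewrite mulr_sumr; apply: eq_bigr => i _.
  by rewrite /w' [k%:R ^+ i.+2]exprS invfM; ring.
have H : series (terms w) m.+1 @[m --> \oo] --> digit_value R w.
  by rewrite (cvg_shiftS (series (terms w))); exact: is_cvg_digit_series.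
apply: (cvg_unique _ H) => //=; rewrite (eq_cvg _ _ E).
apply: cvgM; first exact: cvg_cst.
by apply: cvgD; [exact: cvg_cst | exact: is_cvg_digit_series].
Qed.

(** Self-similarity: fixing the first m digits scales the set of values by k^-m
    and translates it by a multiple of k^-m. *)
Lemma digit_value_prefix w m : digit_value R w =
  b ^+ m * ((radix_value (mkseq w m))%:R + digit_value R (fun i => w (m + i)%N)).
Proof.
elim: m w => [|m IH] w; first by rewrite expr0 mul1r add0r.
have k0 : k%:R != 0 :> R by rewrite pnatr_eq0 -lt0n ltnW.
rewrite digit_value_recl IH mkseq_recl /= size_mkseq natrD natrM natrX exprS.
have bk : b ^+ m * k%:R ^+ m = 1 by rewrite -exprMn mulVf // expr1n.
ring: bk.
Qed.

Lemma digit_value_bounds w m :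
  b ^+ m * (radix_value (mkseq w m))%:R <= digit_value R w <=
  b ^+ m * ((radix_value (mkseq w m))%:R + 1).
Proof.
rewrite (digit_value_prefix w m) !ler_pM2l ?exprn_gt0 ?radix_gt0 //.
by rewrite lerDl lerD2l digit_value_ge0 digit_value_le1.
Qed.
End DigitValue.

Definition coord_value (k n : nat) (j : 'I_n) (s : seq (letter k n)) : nat :=
  radix_value [seq a j | a : letter k n <- s].

Lemma coord_value_inj (k n : nat) (s t : seq (letter k n)) : size s = size t ->
  (forall j, coord_value j s = coord_value j t) -> s = t.
Proof.
move=> st E; have {}E j :
    [seq a j | a : letter k n <- s] = [seq a j | a : letter k n <- t].
  by apply: radix_value_inj (E j); rewrite !size_map.
elim: s t st E => [|a s IH] [|c t] //= [st] E.
congr (_ :: _); first by apply/ffunP => j; case: (E j).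
by apply: IH => // j; case: (E j).
Qed.

Lemma nu_bounds (R : realType) (k n : nat) (w : nat -> letter k n) m (j : 'I_n) :
  (1 < k)%N ->
  (k%:R^-1) ^+ m * (coord_value j (mkseq w m))%:R <= nu R w ord0 j <=
  (k%:R^-1) ^+ m * ((coord_value j (mkseq w m))%:R + 1).
Proof.
move=> hk; have := digit_value_bounds R hk (fun i => w i j) m.
by rewrite /coord_value /mkseq -map_comp mxE.
Qed.

(** The integer corners of two k-adic cubes of side k^-(|u|+m) that contain
    points of E differ by at most 2 in each coordinate, which leaves 5^n
    possibilities.  The prefix u is there to count words readable from a state
    that has been put behind a start state. *)
Lemma num_cubes_met (R : realType) (k n : nat) (E : set 'rV[R]_n)
    (u : seq (letter k n)) (m : nat) : (1 < k)%N ->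
  (forall x y, E x -> E y -> forall j,
     x ord0 j - y ord0 j <= k%:R^-1 ^+ (size u + m)) ->
  (num_strings [set s | exists2 w, mkseq w m = s & E (nu R (prepend u w))] m <=
   5 ^ n)%N.
Proof.
move=> hk Esmall; set P := (X in num_strings X).
have [[s0 [w0 s0E Ew0]]|P0] := pselect (exists s, P s); last first.
  rewrite (_ : num_strings P m = 0%N) //; apply/eqP; rewrite cards_eq0.
  apply/eqP/setP => t; rewrite !finset.inE; apply/asboolP => Pt.
  by apply: P0; exists t.
pose v j s := coord_value j (u ++ s).
have close s s' j : P s -> P s' -> (v j s <= v j s' + 2)%N.
  move=> [w sE Ew] [w' s'E Ew'].
  have := Esmall _ _ Ew Ew' j.
  have /andP[+ _] := nu_bounds R (prepend u w) (size u + m) j hk.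
  have /andP[_ +] := nu_bounds R (prepend u w') (size u + m) j hk.
  rewrite !mkseq_prepend sE s'E -/(v j s) -/(v j s').
  set B := _ ^+ _; move=> h1 h2 h3.
  have B0 : 0 < B by rewrite exprn_gt0 // radix_gt0.
  have : B * (v j s)%:R <= B * ((v j s')%:R + 2) by lra.
  by rewrite ler_pM2l // -natrD ler_nat.
pose f (t : m.-tuple (letter k n)) : {ffun 'I_n -> 'I_5} :=
  [ffun j => inord (v j t + 2 - v j s0)%N].
have -> : (5 ^ n = #|{ffun 'I_n -> 'I_5}|)%N by rewrite card_ffun !card_ord.
have Ps0 : P s0 by exists w0.
have Pt t : t \in [set t : m.-tuple (letter k n) | `[< P t >]]%SET -> P t.
  by rewrite finset.inE => /asboolP.
rewrite /num_strings -(@card_in_imset _ _ f) ?max_card //.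
move=> s t /Pt Ps {}/Pt Pt /ffunP fE.
suff /eqP : u ++ s = u ++ t.
  by rewrite eqseq_cat // => /andP[_ /eqP ?]; exact/val_inj.
apply: coord_value_inj.
  by rewrite !size_cat !size_tuple.
move=> j; have /(congr1 val) := fE j.
rewrite !ffunE /= !inordK -/(v j s) -/(v j t).
- move: (close s0 s j Ps0 Ps) (close s0 t j Ps0 Pt).
  by move: (v j s) (v j t) (v j s0) => x y z; lia.
- by move: (close t s0 j Pt Ps0); move: (v j t) (v j s0) => x y; lia.
- by move: (close s s0 j Ps Ps0); move: (v j s) (v j s0) => x y; lia.
Qed.

(** * Box counting *)

Section Dimension.
Variables (R : realType) (k n : nat) (A : automaton (letter k n)).
Hypotheses (hk : (1 < k)%N) (accT : accept A = [set: state A]%SET).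
Local Notation b := (k%:R^-1 : R).
Local Notation X := (@nu R k n @` omega_language A).
Local Notation L := (num_strings (finite_language A)).

Lemma finite_language_prefix w m :
  omega_language A w -> finite_language A (mkseq w m).
Proof.
move=> /(closed_omega_language w accT)[q qS qw].
by apply/finite_languageE => //; exists q => //; exact: readable_prefix.
Qed.

Lemma boxes_cover (eps : R) m : b ^+ m <= eps ->
  exists c : 'I_(L m) -> 'rV[R]_n, X `<=` \bigcup_i box eps (c i).
Proof.
move=> meps.
pose S := [set t : m.-tuple (letter k n) | `[< finite_language A t >]]%SET.
exists (fun i : 'I_(#|S|) => \row_j (b ^+ m * (coord_value j (enum_val i))%:R)).
move=> _ [w Aw <-].
have sw : size (mkseq w m) == m by rewrite size_mkseq.
have wS : Tuple sw \in S.
  by rewrite finset.inE; apply/asboolP; exact: finite_language_prefix.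
exists (enum_rank_in wS (Tuple sw)) => // j; rewrite mxE enum_rankK_in //=.
have /andP[-> h] := nu_bounds R w m j hk; rewrite (le_trans h) //.
by rewrite mulrDr mulr1 lerD2l.
Qed.

(** Each word of L extends to an infinite word, whose point lies in one of the
    boxes, and num_cubes_met bounds how many words can share a box. *)
Lemma boxes_cover_lower (eps : R) m N (c : 'I_N -> 'rV[R]_n) :
  trim A -> eps <= b ^+ m -> X `<=` \bigcup_i box eps (c i) ->
  (L m <= N * 5 ^ n)%N.
Proof.
move=> tA epsm Xc; have live := trim_live tA.
pose Q i : set (seq (letter k n)) :=
  [set s | exists2 w, mkseq w m = s & box eps (c i) (nu R (prepend [::] w))].
apply: (@leq_trans (\sum_i num_strings (Q i) m)).
  apply: num_strings_cover => s sm /finite_languageE[]// q qS qs.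
  have [w qw ws] := readable_extends live qs.
  have [|i _ ci] := Xc (nu R w).
    by exists w => //; apply/closed_omega_language => //; exists q.
  by exists i, w; rewrite -?sm.
have -> : (N * 5 ^ n = \sum_(i < N) 5 ^ n)%N by rewrite sum_nat_const card_ord.
apply: leq_sum => i _; apply: num_cubes_met => // x y cx cy j.
rewrite add0n (le_trans _ epsm) //.
have := cx j; have := cy j; lra.
Qed.

Lemma finite_language_gt0 m : trim A -> (0 < L m)%N.
Proof.
move=> tA; have /set0Pn[q qS] := start_neq0 A.
have [w qw] := inf_readable_exists q (trim_live tA).
rewrite -(size_mkseq w m); apply: num_strings_gt0.
by apply/finite_languageE => //; exists q => //; exact: readable_prefix.
Qed.

Lemma box_count_le (eps : R) m : b ^+ m <= eps ->
  (box_count eps X <= (L m)%:R%:E)%E.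
Proof.
move=> /boxes_cover cover; apply: ereal_inf_lbound.
by exists (L m).
Qed.

Lemma box_count_ge (eps : R) m : trim A -> eps <= b ^+ m ->
  (((L m)%:R / (5 ^ n)%:R)%:E <= box_count eps X)%E.
Proof.
move=> tA epsm; apply/ereal_infP => _ [N [c Xc] <-].
rewrite lee_fin ler_pdivrMr ?ltr0n ?expn_gt0 // -natrM ler_nat.
exact: boxes_cover_lower Xc.
Qed.

(** * Covers and Hausdorff content *)

Lemma euclidean_dist_coord (x y : 'rV[R]_n) j :
  x ord0 j - y ord0 j <= euclidean_dist x y.
Proof.
rewrite (le_trans (ler_norm _)) // -sqrtr_sqr ler_sqrt.
  by rewrite (bigD1 j) //= lerDl sumr_ge0 // => i _; exact: sqr_ge0.
by rewrite sumr_ge0 // => i _; exact: sqr_ge0.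
Qed.

Lemma diam_box (eps : R) (c : 'rV[R]_n) : 0 <= eps ->
  (diam (box eps c) <= (Num.sqrt n%:R * eps)%:E)%E.
Proof.
move=> eps0; apply/ereal_supP => _ [x [y [cx cy ->]]]; rewrite lee_fin.
rewrite -[X in _ * X]ger0_norm // -sqrtr_sqr -sqrtrM // ler_sqrt; last first.
  by rewrite mulr_ge0 // sqr_ge0.
rewrite -[X in X%:R](card_ord n) mulr_natl -sumr_const; apply: ler_sum => j _.
rewrite -subr_ge0 subr_sqr; have := cx j; have := cy j => ? ?.
by rewrite mulr_ge0 //; lra.
Qed.

Lemma diam_ge0 (U : set 'rV[R]_n) x : U x -> (0 <= diam U)%E.
Proof.
move=> Ux; apply: ereal_sup_ubound; exists x, x; split => //.
by rewrite /euclidean_dist big1 ?sqrtr0 // => j _; rewrite subrr expr0n.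
Qed.

Lemma diam_pow_ge0 s (U : set 'rV[R]_n) : (0 <= diam_pow s U)%E.
Proof. by rewrite /diam_pow; case: ifP => // _; exact: poweR_ge0. Qed.

Lemma hausdorff_content_boxes (Y : set 'rV[R]_n) (s delta eps : R) N
    (c : 'I_N -> 'rV[R]_n) :
  0 <= s -> 0 <= eps -> Num.sqrt n%:R * eps <= delta ->
  Y `<=` \bigcup_i box eps (c i) ->
  (hausdorff_content s delta Y <= (N%:R * (Num.sqrt n%:R * eps) `^ s)%:E)%E.
Proof.
move=> s0 eps0 epsd Yc.
(* the finite cover is padded with empty sets, whose weight is 0 *)
pose U (i : nat) := if insub i is Some j then box eps (c j) else set0.
have Ud i : (diam (U i) <= (Num.sqrt n%:R * eps)%:E)%E.
  rewrite /U; case: insubP => [j _ _|_]; first exact: diam_box.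
  by apply/ereal_supP => d [x [y []]].
have Us i : (diam_pow s (U i) <= ((Num.sqrt n%:R * eps) `^ s)%:E)%E.
  rewrite /diam_pow; case: ifPn => [_|]; first by rewrite lee_fin powR_ge0.
  move=> /set0P[x Ux]; rewrite -poweR_EFin gt0_ler_poweR ?in_itv //=.
  - by rewrite (diam_ge0 Ux) leey.
  - by rewrite lee_fin mulr_ge0 // leey.
apply: (@le_trans _ _ (\sum_(0 <= i <oo) diam_pow s (U i))%E).
  apply: ereal_inf_lbound; exists U => //; split.
    move=> y /Yc[i _ ci]; exists (val i) => //.
    by rewrite /U valK.
  by move=> i; rewrite (le_trans (Ud i)) // lee_fin.
rewrite (nneseries_split 0 N) => [|i _]; last exact: diam_pow_ge0.
rewrite [X in (_ + X)%E]eseries0 ?adde0; last first.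
  move=> i; rewrite add0n /U => Ni _; rewrite insubN -?leqNgt //.
  by rewrite /diam_pow eqxx.
apply: (@le_trans _ _ (\sum_(0 <= i < 0 + N) ((Num.sqrt n%:R * eps) `^ s)%:E)%E).
  by apply: lee_sum => i _.
by rewrite sumEFin lee_fin sumr_const_nat mulr_natl add0n subn0.
Qed.
End Dimension.

(** * Null sets and growth of the language *)

Lemma powR_exprn (R : realType) (a s : R) m :
  0 <= a -> (a ^+ m) `^ s = (a `^ s) ^+ m.
Proof.
move=> a0; rewrite -(powR_mulrn m (powR_ge0 a s)) -powRrM mulrC powRrM.
by rewrite powR_mulrn.
Qed.

Lemma expr_bracket (R : realType) (a t : R) : 0 < a < 1 -> 0 < t <= 1 ->
  exists m, a ^+ m.+1 < t <= a ^+ m.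
Proof.
move=> /andP[a0 a1] /andP[t0 t1].
have /cvgrPdist_lt/(_ t t0)[N _ /(_ N (leqnn N))] :
    a ^+ m @[m --> \oo] --> (0 : R) by apply: cvg_expr; rewrite gtr0_norm.
rewrite /= sub0r normrN gtr0_norm ?exprn_gt0 // => aN.
have ex : exists m, a ^+ m < t by exists N.
case: (ex_minnP ex) => -[|m] am min_m; first by rewrite expr0 ltNge t1 in am.
by exists m; rewrite am /= leNgt; apply/negP => /min_m; rewrite ltnn.
Qed.

Lemma hausdorff_content_ge0 (R : realType) (n : nat) (s delta : R)
  (Y : set 'rV[R]_n) : (0 <= hausdorff_content s delta Y)%E.
Proof.
apply/ereal_infP => _ [U _ <-]; apply: nneseries_ge0 => i _ _.
exact: diam_pow_ge0.
Qed.

(** In dimension zero a single nonempty set of a cover already has weight 1. *)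
Lemma hausdorff_measure_null_gt0 (R : realType) (n : nat) (s : R)
    (Y : set 'rV[R]_n) :
  Y !=set0 -> 0 <= s -> hausdorff_measure s Y = 0%E -> 0 < s.
Proof.
move=> [y Yy]; rewrite le_eqVlt => /predU1P[<- Y0|//].
have : (hausdorff_content 0 1 Y < 1)%E.
  rewrite (le_lt_trans _ lte01) // -Y0; apply: ereal_sup_ubound.
  by exists 1 => //=; exact: ltr01.
case/ereal_inf_lt => _ [U [YU _] <-]; rewrite ltNge => /negP[].
have [i _ Uiy] := YU y Yy.
apply: le_trans (nneseries_lim_ge i.+1 _); last by move=> *; exact: diam_pow_ge0.
rewrite big_nat_recr //= -[leLHS]add0e leeD //.
  by rewrite sume_ge0 // => j _; exact: diam_pow_ge0.
by rewrite /diam_pow; case: ifPn => [/eqP E|_]; [rewrite E in Uiy | rewrite poweRe0].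
Qed.

Lemma cover_diam (R : realType) (n : nat) (s delta : R) (U : set 'rV[R]_n) :
  0 < s -> 0 <= delta -> (diam U <= delta%:E)%E -> exists d : R,
  [/\ 0 <= d <= delta, diam_pow s U = (d `^ s)%:E
    & forall x y, U x -> U y -> forall j, x ord0 j - y ord0 j <= d].
Proof.
move=> s0 delta0 Ud; rewrite /diam_pow; case: ifPn => [/eqP->|/set0P[x Ux]].
  by exists 0; split; rewrite ?lexx ?powR0 // gt_eqF.
have d0 := diam_ge0 Ux.
have dfin : diam U \is a fin_num by rewrite ge0_fin_numE // (le_lt_trans Ud) ?ltry.
exists (fine (diam U)); rewrite -poweR_EFin fineK //; split => //.
  by rewrite -!lee_fin fineK // d0.
move=> y z Uy Uz j; rewrite (le_trans (euclidean_dist_coord y z j)) //.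
by rewrite -lee_fin fineK //; apply: ereal_sup_ubound; exists y, z.
Qed.

(** Trades a diameter d for a scale a^(D + l), where D leaves room for a prefix,
    at the price of a constant factor and of an arbitrarily small additive error
    e.  The error is there because d may be 0, and then l has to be chosen so
    large that (a^l)^s is small. *)
Lemma cover_level (R : realType) (a s d e : R) (D : nat) :
  0 < a < 1 -> 0 < s -> 0 < e -> 0 <= d <= a ^+ D.+1 ->
  exists l, [/\ (0 < l)%N, d <= a ^+ (D + l)
    & (a `^ s) ^+ l <= (d `^ s + e) * (a `^ s) ^- D.+1].
Proof.
move=> a01 s0 e0 /andP[d0 dD]; have /andP[a0 a1] := a01.
pose t := Num.max d (Num.min (a ^+ D.+1) (e `^ s^-1)).
have aD0 j : 0 < a ^+ j by rewrite exprn_gt0.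
have t0 : 0 < t by rewrite lt_max lt_min aD0 powR_gt0 // orbT.
have tD : t <= a ^+ D.+1 by rewrite ge_max dD ge_min lexx.
have ts : t `^ s <= d `^ s + e.
  rewrite /t; have [_|_] := leP d (Num.min _ _); last by rewrite lerDl ltW.
  apply: (@le_trans _ _ ((e `^ s^-1) `^ s)).
    apply: ge0_ler_powR; rewrite ?nnegrE ?powR_ge0 ?(ltW s0) //.
      by rewrite le_min powR_ge0 (ltW (aD0 _)).
    by rewrite ge_min lexx orbT.
  by rewrite -powRrM mulVf ?gt_eqF // powRr1 ?(ltW e0) // lerDr powR_ge0.
have [m /andP[am tm]] : exists m, a ^+ m.+1 < t <= a ^+ m.
  apply: expr_bracket => //; rewrite t0 (le_trans tD) //.
  by rewrite exprn_ile1 // ltW.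
have Dm : (D < m)%N.
  have := lt_le_trans am tD.
  by rewrite ltr_iXn2l // ltnS.
exists (m - D)%N; rewrite subn_gt0 Dm subnKC ?(ltnW Dm) //; split => //.
  by rewrite (le_trans _ tm) // le_max lexx.
rewrite ler_pdivlMr ?exprn_gt0 ?powR_gt0 // -exprD addnS subnK ?(ltnW Dm) //.
rewrite -powR_exprn ?(ltW a0) // (le_trans _ ts) //.
by rewrite ge0_ler_powR ?nnegrE ?(ltW s0) ?(ltW (aD0 _)) ?(ltW t0) ?(ltW am).
Qed.

Section Growth.
Variables (R : realType) (k n : nat) (A : automaton (letter k n)).
Hypotheses (hk : (1 < k)%N) (Aclosed : closed_automaton A).
Let accT : accept A = [set: state A]%SET := Aclosed.2.
Local Notation b := (k%:R^-1 : R).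
Local Notation X := (@nu R k n @` omega_language A).
Local Notation L := (num_strings (finite_language A)).

Lemma recognized_nonempty : X !=set0.
Proof.
have [u uP] := closed_access Aclosed; have /set0Pn[q _] := start_neq0 A.
have [w /uP] := inf_readable_exists q (trim_live Aclosed.1).
by exists (nu R (prepend (u q) w)), (prepend (u q) w).
Qed.

(** Covering X by its level-m cubes costs a constant times |L|_m k^(- s' m),
    which for the given m is at most k^(- (s' - s) m). *)
Lemma growth_hausdorff_null (s s' : R) : 0 <= s < s' ->
  (forall M, exists2 m, (M <= m)%N & (L m)%:R * (b `^ s) ^+ m <= 1) ->
  hausdorff_measure s' X = 0%E.
Proof.
move=> /andP[s0 ss'] freq; have s'0 : 0 <= s' by rewrite (le_trans s0) ?ltW.
have b0 : 0 < b := radix_gt0 R hk; have b1 : b < 1 := radix_lt1 R hk.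
set r := Num.sqrt n%:R : R; have r0 : 0 <= r by exact: sqrtr_ge0.
have to0 (x c e : R) : 0 <= x < 1 -> 0 <= c -> 0 < e ->
    exists N, forall m, (N <= m)%N -> c * x ^+ m <= e.
  move=> /andP[x0 x1] c0 e0.
  have : c * x ^+ m @[m --> \oo] --> c * 0.
    by apply: cvgM; [exact: cvg_cst | apply: cvg_expr; rewrite ger0_norm].
  rewrite mulr0 => /cvgrPdist_le/(_ e e0)[N _ NP]; exists N => m /NP /=.
  by rewrite sub0r normrN; apply: le_trans; exact: ler_norm.
have content0 delta : 0 < delta -> hausdorff_content s' delta X = 0%E.
  move=> delta0; apply/eqP; rewrite eq_le hausdorff_content_ge0 andbT.
  apply/lee_addgt0Pr => e e0; rewrite add0e.
  pose x := b `^ (s' - s).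
  have x1 : 0 <= x < 1.
    rewrite powR_ge0 /= /x /powR (gt_eqF b0) -[ltRHS]expR0 ltr_expR.
    by rewrite pmulr_rlt0 ?subr_gt0 //; apply: ln_lt0; rewrite b0.
  have [N1 N1P] := to0 x (r `^ s') e x1 (powR_ge0 _ _) e0.
  have b01 : 0 <= b < 1 by rewrite ltW.
  have [N2 N2P] := to0 b r delta b01 r0 delta0.
  have [m + Lm] := freq (maxn N1 N2).
  rewrite geq_max => /andP[/N1P m1 /N2P m2].
  have [c Xc] := boxes_cover hk accT (lexx (b ^+ m)).
  have bm0 : 0 <= b ^+ m by rewrite exprn_ge0 // ltW.
  apply: le_trans (hausdorff_content_boxes s'0 bm0 m2 Xc) _.
  rewrite lee_fin (le_trans _ m1) // powRM // powR_exprn ?(ltW b0) //.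
  have -> : b `^ s' = b `^ s * x.
    by rewrite -powRD ?subrKC //; apply/implyP => _; rewrite gt_eqF.
  rewrite exprMn mulrCA [_%:R * _]mulrA [leLHS]mulrCA ler_piMl //.
  by rewrite mulr_ge0 ?exprn_ge0 ?powR_ge0.
apply/eqP; rewrite eq_le; apply/andP; split.
  by apply/ereal_supP => _ [delta /= delta0 <-]; rewrite content0.
by rewrite -(content0 1 ltr01); apply: ereal_sup_ubound; exists 1 => //=.
Qed.

(** Each set U_i of an efficient cover of X is turned into the family W_i of
    words v of length l_i such that, for some state q, an infinite word starting
    with v and put behind u q codes a point of U_i.  Since D bounds the lengths
    of the u q, a diameter of U_i at most k^-(D + l_i) leaves at most 5^n words
    for each q. *)
Lemma hausdorff_null_growth (s : R) : 0 < s -> hausdorff_measure s X = 0%E ->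
  exists2 C, 0 < C & forall m, (L m)%:R * (b `^ s) ^+ m <= C.
Proof.
move=> s0 X0; have b0 : 0 < b := radix_gt0 R hk.
have b01 : 0 < b < 1 by rewrite b0 (radix_lt1 R hk).
have [u uP] := closed_access Aclosed.
pose D := (\max_q size (u q))%N.
set x := b `^ s; have x0 : 0 < x by rewrite powR_gt0.
(* c converts the cost of the cover into the weight of the word families; the
   total cost is kept below 2 e = 1 / c, one e for the diameters and one for
   the errors e / 2^(i+1) allowed by cover_level *)
pose c : R := (#|state A| * 5 ^ n)%:R * x ^- D.+1.
have c0 : 0 < c.
  rewrite divr_gt0 ?exprn_gt0 // ltr0n muln_gt0 expn_gt0 /= andbT.
  by have /set0Pn[q _] := start_neq0 A; apply/card_gt0P; exists q.
pose e := (c *+ 2)^-1; have e0 : 0 < e by rewrite invr_gt0 pmulrn_lgt0.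
have delta0 : 0 < b ^+ D.+1 by rewrite exprn_gt0.
have : (hausdorff_content s (b ^+ D.+1) X < e%:E)%E.
  rewrite (@le_lt_trans _ _ 0%E) ?lte_fin // -X0; apply: ereal_sup_ubound.
  by exists (b ^+ D.+1).
case/ereal_inf_lt => _ [U [XU Ud] <-] Ue.
have /choice[d dP] i := cover_diam s0 (ltW delta0) (Ud i).
have sum_d M : \sum_(0 <= i < M) d i `^ s <= e.
  rewrite -lee_fin (le_trans _ (ltW Ue)) // -sumEFin.
  apply: le_trans (nneseries_lim_ge M _); last by move=> *; exact: diam_pow_ge0.
  by apply: lee_sum => i _; case: (dP i) => _ ->.
have /choice[l lP] i : exists l, [/\ (0 < l)%N, d i <= b ^+ (D + l)
    & x ^+ l <= (d i `^ s + e / 2 ^+ i.+1) * x ^- D.+1].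
  by case: (dP i) => di _ _; apply: cover_level => //; rewrite divr_gt0 // exprn_gt0.
pose V i q : set (seq (letter k n)) :=
  [set v | exists2 w, mkseq w (l i) = v & U i (nu R (prepend (u q) w))].
pose W i : set (seq (letter k n)) := [set v | exists q, V i q v].
have W_le i : (num_strings (W i) (l i) <= #|state A| * 5 ^ n)%N.
  apply: (@leq_trans (\sum_q num_strings (V i q) (l i))).
    by apply: num_strings_cover => v _ [q Vv]; exists q.
  rewrite -sum_nat_const; apply: leq_sum => q _; apply: num_cubes_met => //.
  move=> y z Uy Uz j; have [_ _ /(_ y z Uy Uz j) yz] := dP i.
  rewrite (le_trans yz) //; have [_ dl _] := lP i; rewrite (le_trans dl) //.
  by rewrite ler_wiXn2l ?leq_add2r ?leq_bigmax // ltW // (radix_lt1 R hk).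
have [|q w qw|M|C C0 CP] := @factors_growth R _ A x l W x0.
- by move=> i; case: (lP i).
- have [|i _ Ui] := XU (nu R (prepend (u q) w)).
    by exists (prepend (u q) w) => //; exact: uP.
  by exists i, q, w.
- have half : \sum_(0 <= i < M) e / 2 ^+ i.+1 <= e.
    suff -> : \sum_(0 <= i < M) e / 2 ^+ i.+1 = e * (1 - 2 ^- M).
      by rewrite ler_piMr ?(ltW e0) // gerBl invr_ge0 exprn_ge0.
    elim: M => [|M IH]; first by rewrite big_nil expr0 invr1 subrr mulr0.
    rewrite big_nat_recr //= IH exprS.
    by field; rewrite expf_neq0.
  rewrite -(big_mkord xpredT (fun i => (num_strings (W i) (l i))%:R * x ^+ l i)).
  apply: (@le_trans _ _ (\sum_(0 <= i < M) c * (d i `^ s + e / 2 ^+ i.+1))).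
    apply: ler_sum => i _; have [_ _ xl] := lP i.
    apply: le_trans (ler_wpM2l _ xl) _ => //.
    rewrite /c -[leRHS]mulrA [x ^- D.+1 * _]mulrC ler_wpM2r ?ler_nat ?W_le //.
    exact: le_trans (exprn_ge0 _ (ltW x0)) xl.
  rewrite -mulr_sumr big_split /= -[leRHS](mulfV (lt0r_neq0 c0)) ler_pM2l //.
  rewrite (le_trans (lerD (sum_d M) half)) //.
  by rewrite /e -mulr_natr invfM; lra.
exists C => // m; rewrite (le_trans _ (CP m)) // ler_wpM2r ?exprn_ge0 ?(ltW x0) //.
rewrite ler_nat; apply: num_strings_le => v _ /finite_languageE[]// q _ qv.
by exists q.
Qed.
End Growth.

(** * Equality of the dimensions *)

Section Conclusion.
Variables (R : realType) (k n : nat) (A : automaton (letter k n)).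
Hypotheses (hk : (1 < k)%N) (Aclosed : closed_automaton A).
Let accT : accept A = [set: state A]%SET := Aclosed.2.
Local Notation b := (k%:R^-1 : R).
Local Notation X := (@nu R k n @` omega_language A).
Local Notation L := (num_strings (finite_language A)).

Let L_gt0 m : 0 < (L m)%:R :> R.
Proof. by rewrite ltr0n finite_language_gt0 //; case: Aclosed. Qed.

Lemma ln_radix_gt0 : 0 < ln (k%:R : R).
Proof. by rewrite ln_gt0 // ltr1n. Qed.

Lemma weighted_count_expR (s : R) m :
  (L m)%:R * (b `^ s) ^+ m = expR (ln (L m)%:R - s * ln k%:R * m%:R).
Proof.
have k0 : (k%:R : R) \is Num.pos by rewrite posrE ltr0n ltnW.
rewrite expRD lnK ?posrE //; congr (_ * _).
rewrite /powR gt_eqF ?radix_gt0 // lnV // -expRM_natr; congr expR; ring.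
Qed.

Lemma hausdorff_dim_real : exists2 h : R, 0 <= h & hausdorff_dim X = h%:E.
Proof.
have lower : (0 <= hausdorff_dim X)%E.
  by apply/ereal_infP => _ [s [s0 _] <-]; rewrite lee_fin.
have upper : (hausdorff_dim X <= (n%:R + 1)%:E)%E.
  apply: ereal_inf_lbound; exists (n%:R + 1) => //; split; first by rewrite addr_ge0.
  apply: (growth_hausdorff_null hk Aclosed (s := n%:R)).
    by rewrite ler0n ltrDl ltr01.
  move=> M; exists M => //; rewrite powR_mulrn ?(ltW (radix_gt0 R hk)) //.
  rewrite -exprM exprVn ler_pdivrMr ?exprn_gt0 ?ltr0n 1?ltnW // mul1r -natrX.
  rewrite ler_nat (leq_trans (num_strings_max _ _)) //.
  by rewrite card_ffun !card_ord expnM.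
have fin : hausdorff_dim X \is a fin_num.
  by rewrite ge0_fin_numE // (le_lt_trans upper) ?ltry.
by exists (fine (hausdorff_dim X)); rewrite ?fineK // -lee_fin fineK.
Qed.

Section Rate.
Variable h : R.
Hypotheses (h0 : 0 <= h) (hE : hausdorff_dim X = h%:E).

(** Exponents s slightly above h have null measure, which bounds |L|_m from
    above; a frequently smaller growth rate would make the measure vanish for
    some exponent below h. *)
Lemma growth_rate : ln ((L m)%:R : R) / m%:R @[m --> \oo] --> h * ln k%:R.
Proof.
have lk := ln_radix_gt0.
apply/cvgrPdist_le => e e0.
have [s [sr s0 Xs sh]] : exists s, [/\ 0 <= s, 0 < s,
    hausdorff_measure s X = 0%E & s < h + e / 2 / ln k%:R].
  have : (hausdorff_dim X < (h + e / 2 / ln k%:R)%:E)%E.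
    by rewrite hE lte_fin ltrDl !divr_gt0.
  case/ereal_inf_lt => _ [s [s0 Xs] <-]; rewrite lte_fin => sh.
  exists s; split => //.
  exact: hausdorff_measure_null_gt0 (recognized_nonempty _ Aclosed) s0 Xs.
have [C C0 CP] := hausdorff_null_growth hk Aclosed s0 Xs.
have [N NP] : exists N, forall m, (N <= m)%N ->
    (h * ln k%:R - e) * m%:R <= ln (L m)%:R.
  apply: contrapT => nN; pose s1 := h - e / ln k%:R.
  have s1E : s1 * ln k%:R = h * ln k%:R - e.
    by rewrite /s1 mulrBl divfK // gt_eqF.
  have freq M : exists m, [/\ (M <= m)%N, (0 < m)%N
      & ln (L m)%:R < s1 * ln k%:R * m%:R].
    apply: contrapT => nM; apply: nN; exists M.+1 => m Mm; rewrite -s1E leNgt.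
    apply/negP => Lm; apply: nM; exists m.
    by split => //; [exact: ltnW | exact: leq_ltn_trans Mm].
  have s10 : 0 <= s1.
    have [m [_ m0 Lm]] := freq 0%N.
    have : 0 < s1 * ln k%:R * m%:R.
      by rewrite (le_lt_trans _ Lm) // ln_ge0 // ler1n -(ltr0n R).
    by rewrite pmulr_lgt0 ?ltr0n // pmulr_lgt0 // => /ltW.
  have : hausdorff_measure (h - e / ln k%:R / 2) X = 0%E.
    apply: (growth_hausdorff_null hk Aclosed (s := s1)).
      have := divr_gt0 e0 lk; rewrite s10 /s1 /=; lra.
    move=> M; have [m [Mm _ Lm]] := freq M; exists m => //.
    by rewrite weighted_count_expR -[leRHS]expR0 ler_expR subr_le0 ltW.
  move=> Xs'; have e0' := divr_gt0 e0 lk.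
  have : (h%:E <= (h - e / ln k%:R / 2)%:E)%E.
    rewrite -hE; apply: ereal_inf_lbound; exists (h - e / ln k%:R / 2) => //.
    by split => //; move: s10; rewrite /s1; lra.
  by rewrite lee_fin; lra.
near=> m.
have m0 : 0 < m%:R :> R by rewrite ltr0n; near: m; exact: nbhs_infty_gt.
have mC : 2 * ln C / e <= m%:R by near: m; exact: nbhs_infty_ger.
have NL : (h * ln k%:R - e) * m%:R <= ln (L m)%:R.
  by apply: NP; near: m; exact: nbhs_infty_ge.
have Lu : ln (L m)%:R <= s * ln k%:R * m%:R + ln C.
  have := CP m; rewrite weighted_count_expR -{1}(lnK C0) ler_expR; lra.
have {}sh : s * ln k%:R <= h * ln k%:R + e / 2.
  rewrite -(divfK (lt0r_neq0 lk) (e / 2)) -mulrDl ler_pM2r //.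
  exact: ltW.
rewrite ler_distlC ler_pdivlMr // NL ler_pdivrMr //=.
rewrite (le_trans Lu) //; have := ler_wpM2r (ltW m0) sh.
by move: mC; rewrite ler_pdivrMr //; lra.
Unshelve. all: by end_near.
Qed.

Lemma entropy_dim : entropy R (finite_language A) = (h * ln k%:R)%:E.
Proof.
rewrite /entropy.
have -> : (fun m => (lne (L m)%:R%:E * (m%:R^-1)%:E)%E) =
    (fun m => (ln (L m)%:R / m%:R : R)%:E).
  by apply/funext => m; rewrite lne_EFin.
apply: (cvg_limn_einf_sup _).2.
by apply: cvg_EFin; [exact: nearW | exact: growth_rate].
Qed.

(** Between two consecutive k-adic scales the box count is squeezed between
    |L|_m / 5^n and |L|_(m+1), and log (1 / eps) between m log k and
    (m + 1) log k; on division by m the factor 5^n and the shift from m to m + 1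
    become negligible. *)
Lemma box_ratio_approx (e : R) : 0 < e -> exists N, forall m (eps : R),
  (N <= m)%N -> b ^+ m.+1 < eps <= b ^+ m ->
  exists2 r : R, box_ratio X eps = r%:E & `|h - r| <= e.
Proof.
move=> e0; have lk := ln_radix_gt0; have b0 := radix_gt0 R hk.
pose e' := e * ln (k%:R : R) / 4.
have e'0 : 0 < e' by rewrite divr_gt0 // mulr_gt0.
have /cvgrPdist_le/(_ e' e'0)[N1 _ N1P] := growth_rate.
(* B is the cost of the factor 5^n; m >= c makes the bounded errors
   h log k + B at most half of e m log k, and e' bounds the error of
   growth_rate, which enters at most twice as m + 1 <= 2 m *)
pose B := ln ((5 ^ n)%:R : R); pose c := (h * ln k%:R + B) * 2 / (e * ln k%:R).
have [N2 _ N2P] := nbhs_infty_ger c.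
exists (maxn (maxn N1 N2) 1) => m eps; rewrite !geq_max -andbA.
move=> /and3P[mN1 /N2P /= mN2 m1] /andP[epsl epsu].
have eps0 : 0 < eps by rewrite (lt_trans _ epsl) // exprn_gt0.
have five0 : 0 < (5 ^ n)%:R :> R by rewrite ltr0n expn_gt0.
have lo := box_count_ge hk accT Aclosed.1 epsu.
have hi := box_count_le hk accT (ltW epsl).
have cfin : box_count eps X \is a fin_num.
  by rewrite fin_numElt (lt_le_trans (ltNyr _) lo) (le_lt_trans hi (ltry _)).
move: lo hi; rewrite /box_ratio -(fineK cfin); set v := fine _.
rewrite !lee_fin => lo hi.
have v0 : 0 < v by rewrite (lt_le_trans _ lo) // divr_gt0.
exists (ln v / ln eps^-1); first by rewrite lne_EFin.
set t := ln eps^-1.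
have lnb j : ln (b ^+ j) = - (ln k%:R * j%:R).
  by rewrite lnXn // lnV ?posrE ?ltr0n 1?ltnW // mulNrn mulr_natr.
have tl : ln k%:R * m%:R <= t.
  rewrite /t lnV ?posrE // lerNr -lnb ler_ln ?posrE ?exprn_gt0 //.
have tu : t <= ln k%:R * (m%:R + 1).
  rewrite /t lnV ?posrE // lerNl natr1 -lnb ler_ln ?posrE ?exprn_gt0 //.
  exact: ltW.
have m0 : 0 < m%:R :> R by rewrite ltr0n.
have t0 : 0 < t by rewrite (lt_le_trans _ tl) // mulr_gt0.
have Lm j : (N1 <= j)%N -> (0 < j)%N ->
    `|ln (L j)%:R - h * ln k%:R * j%:R| <= e' * j%:R.
  move=> /N1P /= N1j j0; have j0' : 0 < j%:R :> R by rewrite ltr0n.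
  rewrite -{2}(gtr0_norm j0') -ler_pdivrMr ?normr_gt0 ?gt_eqF //.
  rewrite -normf_div mulrBl mulfK ?gt_eqF // distrC //.
have lov : ln (L m)%:R - B <= ln v.
  by rewrite /B -ln_div ?posrE // ler_ln ?posrE // divr_gt0.
have hiv : ln v <= ln (L m.+1)%:R by rewrite ler_ln ?posrE.
have := Lm m mN1 m1; rewrite ler_distl => /andP[Lm1 _].
have := Lm m.+1 (leqW mN1) isT; rewrite ler_distl -natr1 => /andP[_ Lm2].
have B0 : 0 <= B by rewrite ln_ge0 // ler1n expn_gt0.
have ce : h * ln k%:R + B <= e * ln k%:R * m%:R / 2.
  move: mN2; rewrite /c ler_pdivrMr ?mulr_gt0 //; lra.
have m1' : 1 <= m%:R :> R by rewrite ler1n.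
have e'm : e' <= e' * m%:R by rewrite ler_peMr // ltW.
have ht1 : h * (ln k%:R * m%:R) <= h * t by rewrite ler_wpM2l.
have ht2 : h * t <= h * (ln k%:R * (m%:R + 1)) by rewrite ler_wpM2l.
have et : e * (ln k%:R * m%:R) <= e * t by rewrite ler_wpM2l // ltW.
have e'E : e' * m%:R * 4 = e * (ln k%:R * m%:R) by rewrite /e'; field.
rewrite ler_distlC ler_pdivlMr // ler_pdivrMr //.
apply/andP; split; lra.
Qed.

Lemma box_ratio_cvg : box_ratio X eps @[eps --> 0^'+] --> h%:E.
Proof.
have b0 := radix_gt0 R hk; have b1 := radix_lt1 R hk.
have near_approx e : 0 < e -> \forall eps \near (0:R)^'+,
    exists2 r : R, box_ratio X eps = r%:E & `|h - r| <= e.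
  move=> /box_ratio_approx[N NP].
  near=> eps.
  have eps0 : 0 < eps by near: eps; exact: nbhs_right_gt.
  have epsN : eps < b ^+ N.
    by near: eps; apply: nbhs_right_lt; rewrite exprn_gt0.
  have [||m epsm] := @expr_bracket R b eps; first by rewrite b0.
    by rewrite eps0 (le_trans (ltW epsN)) // exprn_ile1 // ltW.
  apply: (NP m) => //; rewrite -ltnS.
  have /andP[/lt_trans/(_ epsN) + _] := epsm.
  by rewrite ltr_iXn2l.
apply/fine_cvgP; split.
  by apply: filterS (near_approx 1 ltr01) => eps [r -> _].
apply/cvgrPdist_le => e /near_approx; apply: filterS => eps [r /= -> //].
Unshelve. all: by end_near.
Qed.
End Rate.
End Conclusion.


Theorem theoremA (R : realType) (k n : nat) (hk : (2 <= k)%N) (hn : (1 <= n)%N)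
    (X : set 'rV[R]_n) (A : automaton (letter k n))
    (hXclosed : closed X) (hXauto : automatic k X)
    (hA : recognizes A X) (hAclosed : closed_automaton A) :
  [/\ box_dim_exists X,
      hausdorff_dim X = box_dim X
    & box_dim X = (((ln k%:R)^-1)%:E * entropy R (finite_language A))%E].
Proof.
have [<- _] := hA.
have [h h0 hE] := hausdorff_dim_real R hk hAclosed.
have box_cvg := box_ratio_cvg hk hAclosed h0 hE.
have box_dimE : box_dim (@nu R k n @` omega_language A) = h%:E.
  exact: cvg_lim box_cvg.
split; first exact: cvgP box_cvg.
  by rewrite box_dimE.
rewrite box_dimE (entropy_dim hk hAclosed hE) -EFinM mulrC mulfK //.
by rewrite gt_eqF // ln_radix_gt0.
Qed.
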